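(* The group $\mathrm{Iso}(\mathbb U)$ of all isometries of the complete separable Urysohn space $\mathbb U$, equipped with the standard (pointwise $=$ compact-open) topology, is extremely amenable (has the fixed point on compacta property).
   Context: $\mathbb U$ is the unique (up to isometry) complete separable metric space such that whenever $A\subseteq\mathbb U$ is a finite metric subspace and $A'=A\cup\{a\}$ is a one-point metric space extension of $A$, the embedding $A\hookrightarrow\mathbb U$ extends to an isometric embedding $A'\hookrightarrow\mathbb U$. $\mathrm{Iso}(\mathbb U)$ consists of the isometries of $\mathbb U$ onto itself. A topological group is extremely amenable (has the fixed point on compacta property) if every continuous action of it on a (nonempty) compact space has a fixed point. *)

(* Defs.v *)
From HB Require Import structures.
From mathcomp Require Import all_boot all_order all_algebra.
From mathcomp Require Import all_classical all_reals topology.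

Set Implicit Arguments.
Unset Strict Implicit.
Unset Printing Implicit Defensive.

Import Order.TTheory GRing.Theory Num.Theory.

Local Open Scope classical_set_scope.
Local Open Scope ring_scope.

HB.structure Definition PreTopologicalGroup :=
  {G of Topological G & Group G}.

HB.mixin Record PreTopologicalGroup_isTopologicalGroup G
    & PreTopologicalGroup G := {
  mulg_continuous : continuous (fun p : G * G => (p.1 * p.2)%g) ;
  invg_continuous : continuous (fun g : G => g^-1%g)
}.

#[short(type="topologicalGroupType")]
HB.structure Definition TopologicalGroup :=
  {G of PreTopologicalGroup G & PreTopologicalGroup_isTopologicalGroup G}.

(* Compact spaces are Hausdorff here: any group acts continuously and without
   fixed points on itself equipped with the indiscrete topology. *)
Definition extremely_amenable (G : topologicalGroupType) : Prop :=
  forall (X : topologicalType) (act : G -> X -> X),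
    [set: X] !=set0 -> compact [set: X] -> hausdorff_space X ->
    (forall x, act 1%g x = x) ->
    (forall g h x, act (g * h)%g x = act g (act h x)) ->
    continuous (fun p : G * X => act p.1 p.2) ->
    exists x, forall g, act g x = x.

Section urysohn_space.
Context {R : realType}.

(* Same condition as in [completeType], which would moreover require a
   distinguished point. *)
Definition complete_space (U : metricType R) : Prop :=
  forall F : set_system U, ProperFilter F -> cauchy F -> exists x : U, F --> x.

Definition separable_space (U : metricType R) : Prop :=
  exists2 D : set U, countable D & dense D.

(* [B], [j] and [b] present a one-point extension of the finite subspace [A]:
   [j] embeds [A] isometrically in [B], its values outside [A] are irrelevant,
   and [B] is the union of [j @` A] and [b]. The case [A = set0] makes [U]
   nonempty. *)
Definition one_point_extension_property (U : metricType R) : Prop :=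
  forall (A : set U) (B : metricType R) (j : U -> B) (b : B),
    finite_set A ->
    (forall x y, A x -> A y -> mdist (j x) (j y) = mdist x y) ->
    j @` A `|` [set b] = [set: B] ->
    exists k : B -> U,
      (forall s t, mdist (k s) (k t) = mdist s t) /\
      (forall x, A x -> k (j x) = x).

(* These properties characterize the Urysohn space up to isometry. *)
Record urysohn_space (U : metricType R) : Prop := {
  urysohn_complete : complete_space U ;
  urysohn_separable : separable_space U ;
  urysohn_extension : one_point_extension_property U
}.

End urysohn_space.

Section isometry_group.
Context {R : realType} (U : metricType R).

Definition surjective_isometry : set {ptws U -> U} :=
  [set f | (forall x y, mdist (f x) (f y) = mdist x y) /\ range f = setT].

Definition Iso : Type := set_type surjective_isometry.

HB.instance Definition _ :=
  Topological.copy Iso (set_type surjective_isometry).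

Definition iso_fun (g : Iso) : U -> U := \val g.

Lemma iso_dist g x y : mdist (iso_fun g x) (iso_fun g y) = mdist x y.
Proof. by have [+ _] := set_valP g; apply. Qed.

Lemma iso_surj g y : exists x, iso_fun g x = y.
Proof.
have [_ gT] := set_valP g.
have [x _ <-] : range (iso_fun g) y by rewrite [range _]gT.
by exists x.
Qed.

Lemma iso_inj g : injective (iso_fun g).
Proof.
by move=> x y gxy; apply: mdist_positivity; rewrite -(iso_dist g) gxy mdistxx.
Qed.

Lemma iso_ext g h : iso_fun g =1 iso_fun h -> g = h.
Proof. by move=> gh; apply: val_inj; apply/funext. Qed.

Lemma mkiso_subproof (f : U -> U) :
  (forall x y, mdist (f x) (f y) = mdist x y) -> (forall y, exists x, f x = y) ->
  surjective_isometry f.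
Proof.
move=> fd fs; split=> //; apply/seteqP; split=> // y _.
by have [x <-] := fs y; exists x.
Qed.

Definition mkiso f fd fs : Iso :=
  exist _ (f : {ptws U -> U}) (mem_set (@mkiso_subproof f fd fs)).

Definition iso_one : Iso :=
  @mkiso idfun (fun _ _ => erefl) (fun y => ex_intro _ y erefl).

Lemma iso_mul_dist g h x y :
  mdist ((iso_fun g \o iso_fun h) x) ((iso_fun g \o iso_fun h) y) = mdist x y.
Proof. by rewrite /= !iso_dist. Qed.

Lemma iso_mul_surj g h y : exists x, (iso_fun g \o iso_fun h) x = y.
Proof.
by have [z <-] := iso_surj g y; have [x <-] := iso_surj h z; exists x.
Qed.

Definition iso_mul g h : Iso := mkiso (iso_mul_dist g h) (iso_mul_surj g h).

Definition iso_invfun g (y : U) : U := sval (cid (iso_surj g y)).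

Lemma iso_invfunK g : cancel (iso_invfun g) (iso_fun g).
Proof. by move=> y; rewrite /iso_invfun; case: cid. Qed.

Lemma iso_funK g : cancel (iso_fun g) (iso_invfun g).
Proof. by move=> x; apply: (@iso_inj g); rewrite iso_invfunK. Qed.

Lemma iso_inv_dist g x y :
  mdist (iso_invfun g x) (iso_invfun g y) = mdist x y.
Proof. by rewrite -(iso_dist g) !iso_invfunK. Qed.

Lemma iso_inv_surj g y : exists x, iso_invfun g x = y.
Proof. by exists (iso_fun g y); rewrite iso_funK. Qed.

Definition iso_inv g : Iso := mkiso (iso_inv_dist g) (iso_inv_surj g).

Fact iso_mulA : associative iso_mul.
Proof. by move=> f g h; apply: iso_ext. Qed.

Fact iso_mul1 : left_id iso_one iso_mul.
Proof. by move=> g; apply: iso_ext. Qed.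

Fact iso_1mul : right_id iso_one iso_mul.
Proof. by move=> g; apply: iso_ext. Qed.

Fact iso_mulV : left_inverse iso_one iso_inv iso_mul.
Proof. by move=> g; apply: iso_ext => x; exact: iso_funK. Qed.

Fact iso_Vmul : right_inverse iso_one iso_inv iso_mul.
Proof. by move=> g; apply: iso_ext => x; exact: iso_invfunK. Qed.

HB.instance Definition _ :=
  isGroup.Build Iso iso_mulA iso_mul1 iso_1mul iso_mulV iso_Vmul.

Lemma iso_cvgP (F : set_system Iso) (g : Iso) : Filter F ->
  F --> g <-> forall x, (fun h => iso_fun h x) @ F --> iso_fun g x.
Proof.
move=> FF.
have -> : F --> g <-> {ptws, (iso_fun @ F) --> iso_fun g}.
  split=> [Fg|Fg].
    have /= cval := @initial_continuous Iso {ptws U -> U} set_val g.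
    by move=> A /cval /Fg.
  move=> A [_ [[B oB <-] Bg] BA].
  by apply: (filterS BA); apply: Fg; exact: open_nbhs_nbhs.
exact: pointwise_cvgP.
Qed.

Fact iso_mul_continuous : continuous (fun p : Iso * Iso => (p.1 * p.2)%g).
Proof.
move=> [g h]; apply/iso_cvgP => x; apply/cvg_ballP => e e0.
have e20 : 0 < e / 2 by rewrite divr_gt0.
have /iso_cvgP/(_ (iso_fun h x))/cvg_ballP/(_ _ e20) Hg : nbhs g --> g by [].
have /iso_cvgP/(_ x)/cvg_ballP/(_ _ e20) Hh : nbhs h --> h by [].
exists ([set k | ball (iso_fun g (iso_fun h x)) (e / 2) (iso_fun k (iso_fun h x))],
        [set k | ball (iso_fun h x) (e / 2) (iso_fun k x)]); first by split.
move=> [k l] [/= Hk Hl]; rewrite [e]splitr.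
apply: (ball_triangle Hk); move: Hl.
by rewrite !ballEmdist /= iso_dist.
Qed.

Fact iso_inv_continuous : continuous (fun g : Iso => g^-1%g).
Proof.
move=> g.
have FF : Filter ((fun h : Iso => h^-1%g) @ nbhs g) by exact: fmap_filter.
apply/iso_cvgP.
move=> x; apply/cvg_ballP => e e0.
have /iso_cvgP/(_ (iso_invfun g x))/cvg_ballP/(_ _ e0) Hg : nbhs g --> g by [].
apply: filterS Hg => h /=; rewrite !ballEmdist /= => Hh.
by rewrite -(iso_dist h) iso_invfunK metric_sym -[x in mdist x _](iso_invfunK g).
Qed.

HB.instance Definition _ := PreTopologicalGroup_isTopologicalGroup.Build Iso
  iso_mul_continuous iso_inv_continuous.

End isometry_group.

(* Main.v *)
Require Import Defs.
From mathcomp Require Import all_boot all_order all_algebra all_fingroup.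
From mathcomp Require Import finmap.
From mathcomp Require Import all_classical all_reals topology.
From HB Require Import structures.
From mathcomp Require Import ring lra.

(** The proof is a Ramsey argument driven by concentration of measure, after
    Pestov.

    Suppose that [Iso U] acts on a compact Hausdorff space [X] without fixed
    points. Every point [x] is moved by some isometry, so by compactness [X] is
    covered by finitely many open sets [N i], each moved off itself by some
    [(g i)^-1], and by every [v] that agrees with [(g i)^-1] up to [delta] on a
    finite subset of [U]. Colour [h : Iso U] by some [i] with
    [N i (h^-1 x0)]. Lemma [isometry_ramsey] finds two isometries [h] and [h']
    of the same colour [i] such that [h'] is close to [h \o g i] on a given
    finite set [F]. Then [v := h'^-1 h] is close to [(g i)^-1], yet it maps the
    point [h^-1 x0] of [N i] to the point [h'^-1 x0] of [N i]: a contradiction.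

    To find [h] and [h'], let [Y] be the finite set [F] together with its images
    under the [g i]. A finite set [S] with a permutation [tau (g i)] for each
    [i] is constructed, together with a pseudometric on [S * Y] for which every
    slice [{s} * Y] is a copy of [Y], and for which the point [g i z] of slice
    [s] is very close to the point [z] of slice [tau (g i) s] (lemma
    [finite_translation_model]). Average this pseudometric over [n] coordinates:
    on [S^n * Y], each slice is still a copy of [Y], the translation property
    persists, and slices indexed by tuples at Hamming distance [k] are within
    [D * k / n] of each other. By the extension property this finite space
    embeds in [U], and by ultrahomogeneity (lemma [urysohn_ultrahomogeneous])
    each slice is the restriction to [Y] of an isometry [h s] of [U] (lemma
    [hamming_isometries]). Now [i] can be chosen so that the tuples [s] with
    [h s] of colour [i] form a set [A] of density at least one over the number
    of colours. The preimage of [A] under the translation by [tau (g i)] has the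
    same density. In a high power [S^n] two sets of density bounded below are at
    small normalized Hamming distance, whatever the size of [S] (lemma
    [concentration]), so there are [s] in [A] and [t] close to [s] whose
    translate is in [A]: take for [h] and [h'] the isometries of [s] and of the
    translate of [t]. *)

Set Implicit Arguments.
Unset Strict Implicit.
Unset Printing Implicit Defensive.

Import Order.TTheory GRing.Theory Num.Theory.

Local Open Scope classical_set_scope.
Local Open Scope ring_scope.

(** * Pseudometrics *)

Definition pseudometric {R : realType} (X : Type) (d : X -> X -> R) :=
  [/\ forall x, d x x = 0, forall x y, d x y = d y x
    & forall y x z, d x z <= d x y + d y z].

Section sup_dist.
Context {R : realType} (X : Type) (I : eqType) (J : seq I) (f : I -> X -> R).

(** The pullback of the supremum metric under the map into [R^J] with
    coordinates [f i]. *)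
Definition sup_dist x y := \big[Num.max/0]_(i <- J) `|f i x - f i y|.

Lemma sup_dist_le x y c :
  0 <= c -> {in J, forall i, `|f i x - f i y| <= c} -> sup_dist x y <= c.
Proof. by move=> c0 fc; rewrite /sup_dist big_seq; apply: bigmax_le. Qed.

Lemma le_sup_dist x y i : i \in J -> `|f i x - f i y| <= sup_dist x y.
Proof.
move=> iJ.
exact: (@le_bigmax_seq _ _ _ J 0 i predT (fun i => `|f i x - f i y|) iJ).
Qed.

Lemma sup_dist_ge0 x y : 0 <= sup_dist x y.
Proof. exact: bigmax_ge_id. Qed.

Lemma sup_dist_pseudometric : pseudometric sup_dist.
Proof.
split=> [x|x y|y x z].
- apply/le_anti; rewrite sup_dist_ge0 andbT; apply: sup_dist_le => // i _.
  by rewrite subrr normr0.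
- by apply: eq_bigr => i _; rewrite distrC.
- apply: sup_dist_le => [|i iJ]; first by rewrite addr_ge0 ?sup_dist_ge0.
  apply: le_trans (ler_distD (f i y) _ _) _.
  by apply: lerD; exact: le_sup_dist.
Qed.

End sup_dist.

Lemma mean_pseudometric (R : realType) (X : Type) (rho : X -> X -> R) n :
  pseudometric rho ->
  pseudometric (fun p q : 'I_n -> X => n%:R^-1 * \sum_i rho (p i) (q i)).
Proof.
move=> [rxx rsym rtri]; split=> [p|p q|q p r].
- by rewrite big1 ?mulr0.
- by congr (_ * _); apply: eq_bigr.
- rewrite -mulrDr -big_split ler_wpM2l ?invr_ge0 //.
  by apply: ler_sum => i _; exact: rtri.
Qed.

(** * Realizing finite spaces in the Urysohn space *)

Section katetov.
Context {R : realType} (U : metricType R).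
Context (ext : one_point_extension_property U).

(** The extension property, in terms of Katetov functions: these are exactly the
    distances to the new point of a one-point extension. A Katetov function that
    vanishes somewhere is the distance to that point of [s]; otherwise adding a
    point to [s] does give a metric space, as distinct points are at positive
    distance. *)
Lemma katetov_realized (s : seq U) (f : U -> R) :
  {in s &, forall x y, f x - f y <= mdist x y} ->
  {in s &, forall x y, mdist x y <= f x + f y} ->
  exists z, {in s, forall x, mdist x z = f x}.
Proof.
move=> fL fK.
have f0 x : x \in s -> 0 <= f x.
  by move=> xs; have := fK x x xs xs; rewrite mdistxx; lra.
have [/hasP[z zs /eqP fz]|/hasPn fN0] := boolP (has (fun x => f x == 0) s).
  exists z => x xs; have := fL x z xs zs; have := fK x z xs zs.
  by rewrite fz subr0 addr0 => h1 h2; apply/le_anti/andP.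
pose T := option (seq_sub s).
pose d (p q : T) : R := match p, q with
  | Some x, Some y => mdist (val x) (val y)
  | Some x, None | None, Some x => f (val x)
  | None, None => 0 end.
have fpos (x : seq_sub s) : f (val x) <> 0 by apply/eqP/fN0/valP.
have dxx p : d p p = 0 by case: p => //= x; exact: mdistxx.
have dpos p q : d p q = 0 -> p = q.
  case: p q => [x|] [y|] //= h; try by case: (fpos _ h).
  by congr Some; apply: val_inj; exact: mdist_positivity h.
have dsym p q : d p q = d q p by case: p q => [x|] [y|] //=; exact: metric_sym.
have dtri q p r : d p r <= d p q + d q r.
  case: p q r => [x|] [y|] [z|] /=; rewrite ?add0r ?addr0 //.
  - exact: metric_triangle.
  - by rewrite -lerBlDr; exact: fL (valP x) (valP y).
  - exact: fK (valP x) (valP z).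
  - by rewrite addrC -lerBlDr metric_sym; exact: fL (valP z) (valP y).
  - by apply: addr_ge0; apply: f0; exact: valP.
pose B : metricType R := HB.pack T (isMetric.Build R T dxx dpos dsym dtri).
pose j x : B := if insub x is Some y then Some y else None.
have [||k [kd kj]] := @ext [set` s] B j None (finite_seq s).
- by move=> x y /= xs ys; rewrite /j !insubT.
- apply/seteqP; split=> // -[x|] _; [left|by right].
  by exists (val x); [exact: valP|rewrite /j valK].
exists (k None) => x xs; rewrite -[in LHS](kj x xs) kd /j insubT.
by [].
Qed.

(** A version for families of points, possibly with repetitions: the bounds
    force [f] to agree on indices of the same point. *)
Lemma katetov_realized_fam (I : eqType) (s : seq I) (k : I -> U) (f : I -> R) :
  {in s &, forall i j, f i - f j <= mdist (k i) (k j)} ->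
  {in s &, forall i j, mdist (k i) (k j) <= f i + f j} ->
  exists z, {in s, forall i, mdist (k i) z = f i}.
Proof.
case: s => [|i0 s].
  have [//|//|z _] := @katetov_realized [::] (fun=> 0).
  by exists z.
set t := i0 :: s => fL fK.
(* [c u] is an index of the point [u]. *)
pose c u := nth i0 t (find (fun i => k i == u) t).
have ct i : i \in t -> c (k i) \in t /\ k (c (k i)) = k i.
  move=> it; have ht : has (fun j => k j == k i) t by apply/hasP; exists i.
  by split; [rewrite mem_nth -?has_find|apply/eqP/(nth_find i0 ht)].
have cf i : i \in t -> f (c (k i)) = f i.
  move=> it; have [ci kci] := ct i it.
  have := fL _ _ it ci; have := fL _ _ ci it; rewrite kci mdistxx; lra.
have [||z zP] := @katetov_realized (map k t) (f \o c).
- by move=> _ _ /mapP[i it ->] /mapP[j jt ->]; rewrite /= !cf ?fL.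
- by move=> _ _ /mapP[i it ->] /mapP[j jt ->]; rewrite /= !cf ?fK.
by exists z => i it; rewrite zP ?map_f //= cf.
Qed.

Lemma finite_pseudometric_embeds (T : finType) (d : T -> T -> R) :
  pseudometric d ->
  exists k : T -> U, forall x y, mdist (k x) (k y) = d x y.
Proof.
move=> [dxx dsym dtri].
have [//|//|u0 _] := @katetov_realized [::] (fun=> 0).
suff [k kP] : exists k : T -> U,
    {in enum T &, forall x y, mdist (k x) (k y) = d x y}.
  by exists k => x y; rewrite kP ?mem_enum.
elim: (enum T) => [|t s [k kP]]; first by exists (fun=> u0).
have [||z zP] := @katetov_realized_fam _ s k (d t).
- by move=> x y xs ys; rewrite kP // lerBlDr addrC [d x y]dsym; exact: dtri.
- by move=> x y xs ys; rewrite kP // [d t x]dsym; exact: dtri.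
have zP' x : x \in t :: s -> x <> t -> mdist (k x) z = d t x.
  by rewrite inE => /orP[/eqP//|xs _]; exact: zP.
exists (fun x => if x == t then z else k x) => x y xs ys.
case: (eqVneq x t) => [->|/eqP xt]; case: (eqVneq y t) => [->|/eqP yt].
- by rewrite mdistxx dxx.
- by rewrite metric_sym zP'.
- by rewrite zP' // dsym.
- by move: xs ys; rewrite !inE => /orP[/eqP//|xs] /orP[/eqP//|ys]; rewrite kP.
Qed.

End katetov.

(** * Ultrahomogeneity *)

Section homogeneity.
Context {R : realType} (U : metricType R).

Definition preserves_mdist (P : U -> U -> Prop) :=
  forall x y x' y', P x y -> P x' y' -> mdist x x' = mdist y y'.

Definition dense_domain (P : U -> U -> Prop) :=
  forall x e, 0 < e -> exists x' y', P x' y' /\ mdist x x' < e.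

Lemma close_mdist (x y z : U) e : mdist x y < e -> `|mdist x z - mdist y z| < e.
Proof.
have := metric_triangle x y z; have := metric_triangle y x z.
rewrite [mdist y x]metric_sym => h1 h2 h3.
by rewrite ltr_norml; apply/andP; split; lra.
Qed.

(** The image [z] of [x] under the isometry that [P] should extend to: the
    images of the points near [x] form a Cauchy filter, and [z] is its limit. *)
Lemma preserves_mdist_limit (P : U -> U -> Prop) :
  complete_space U -> preserves_mdist P -> dense_domain P ->
  forall x, exists z, forall x' y', P x' y' -> mdist z y' = mdist x x'.
Proof.
move=> complU Pd Pdense x.
pose near_image e := [set y' | exists x', P x' y' /\ mdist x x' < e].
pose F := filter_from [set e : R | 0 < e] near_image.
have FF : Filter F.
  apply: filter_from_filter; first by exists 1; exact: ltr01.
  move=> d e /= d0 e0; exists (Num.min d e); first by rewrite /= lt_min d0 e0.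
  by move=> y [x' [Pxy]]; rewrite lt_min => /andP[xd xe]; split; exists x'.
have PF : ProperFilter F.
  apply: filter_from_proper => e /= e0.
  by have [x' [y' [Pxy xe]]] := Pdense x e e0; exists y', x'.
have FC : cauchy F.
  apply: cauchy_exP => e e0; have e20 : 0 < e / 2 by lra.
  have [x' [y' [Pxy xe]]] := Pdense x (e / 2) e20.
  exists y'; exists (e / 2) => /=; first lra.
  move=> y [x'' [Pxy' xe']]; rewrite ballEmdist /= -(Pd _ _ _ _ Pxy Pxy').
  have := metric_triangle x' x x''; rewrite [mdist x' x]metric_sym; lra.
have [z Fz] := complU F PF FC; exists z => x' y' Pxy.
apply/eqP; apply: contraT => zx; exfalso.
pose e := `|mdist z y' - mdist x x'| / 2.
have e0 : 0 < e by rewrite divr_gt0 // normr_gt0 subr_eq0.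
have [d /= d0 dz] : F (ball z e) by apply: Fz; exact: nbhsx_ballx.
have de0 : 0 < Num.min d e by rewrite lt_min d0 e0.
have [x2 [y2 [Pxy2]]] := Pdense x _ de0.
rewrite lt_min => /andP[xd xe].
have : ball z e y2 by apply: dz; exists x2.
rewrite ballEmdist /= => /(close_mdist y').
rewrite -(Pd _ _ _ _ Pxy2 Pxy).
have := close_mdist x' xe.
rewrite ltr_norml => /andP[h1 h2]; rewrite ltr_norml => /andP[h3 h4].
have : `|mdist z y' - mdist x x'| < 2 * e.
  by rewrite ltr_norml; apply/andP; split; lra.
rewrite /e; lra.
Qed.

Lemma preserves_mdist_sym P :
  preserves_mdist P -> preserves_mdist (fun x y => P y x).
Proof. by move=> Pd x y x' y' /Pd/[apply]. Qed.

(** The same completion applied to the converse of [P] gives surjectivity. *)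
Lemma preserves_mdist_extends (P : U -> U -> Prop) :
  complete_space U -> preserves_mdist P ->
  dense_domain P -> dense_domain (fun x y => P y x) ->
  exists g : Iso U, forall x y, P x y -> iso_fun g x = y.
Proof.
move=> complU Pd Pdom Pran.
have [g gP] := choice (preserves_mdist_limit complU Pd Pdom).
have gx x y : P x y -> g x = y.
  by move=> /[dup] Pxy /gP h; apply: mdist_positivity; rewrite h mdistxx.
have gd x y : mdist (g x) (g y) = mdist x y.
  apply/eqP; apply: contraT => zx; exfalso.
  pose e := `|mdist (g x) (g y) - mdist x y| / 2.
  have e0 : 0 < e by rewrite divr_gt0 // normr_gt0 subr_eq0.
  have [x' [y' [Pxy xe]]] := Pdom x e e0.
  have ge : mdist (g x) y' < e by rewrite (gP _ _ _ Pxy).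
  have := close_mdist (g y) ge; have := close_mdist y xe.
  rewrite [mdist y' _]metric_sym (gP _ _ _ Pxy) [mdist y x']metric_sym.
  rewrite ltr_norml => /andP[h1 h2]; rewrite ltr_norml => /andP[h3 h4].
  have : `|mdist (g x) (g y) - mdist x y| < 2 * e.
    by rewrite ltr_norml; apply/andP; split; lra.
  rewrite /e; lra.
have gs y : exists x, g x = y.
  have [x xP] := preserves_mdist_limit complU (preserves_mdist_sym Pd) Pran y.
  exists x; apply: mdist_positivity; apply/eqP; apply: contraT => zx; exfalso.
  have e0 : 0 < mdist (g x) y / 2.
    by rewrite divr_gt0 // lt_neqAle mdist_ge0 andbT eq_sym.
  have [y' [x' [Pxy xe]]] := Pran y _ e0.
  have := metric_triangle (g x) y' y.
  by rewrite (gP _ _ _ Pxy) (xP _ _ Pxy) [mdist y' y]metric_sym; lra.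
by exists (mkiso gd gs).
Qed.

Definition partial_isometry (s : seq (U * U)) :=
  {in s &, forall p q, mdist p.1 q.1 = mdist p.2 q.2}.

Definition swap_pairs (s : seq (U * U)) := [seq (p.2, p.1) | p <- s].

Lemma partial_isometry_swap s :
  partial_isometry s -> partial_isometry (swap_pairs s).
Proof. by move=> sP _ _ /mapP[p ps ->] /mapP[q qs ->] /=; rewrite sP. Qed.

Context (hU : urysohn_space U).

Lemma partial_isometry_forth s u : partial_isometry s ->
  exists v, partial_isometry ((u, v) :: s).
Proof.
move=> sP.
have [||v vP] := @katetov_realized_fam _ _ (urysohn_extension hU) _ s snd
  (fun p => mdist p.1 u).
- move=> p q ps qs; rewrite -sP //; have := metric_triangle p.1 q.1 u; lra.
- move=> p q ps qs; rewrite -sP //.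
  by rewrite [mdist q.1 u]metric_sym; exact: metric_triangle.
exists v => p q; rewrite !inE => /orP[/eqP->|ps] /orP[/eqP->|qs] /=.
- by rewrite !mdistxx.
- by rewrite metric_sym -vP // metric_sym.
- by rewrite vP.
- exact: sP.
Qed.

Lemma partial_isometry_step s u : partial_isometry s ->
  exists s', [/\ partial_isometry s', {subset s <= s'},
    exists v, (u, v) \in s' & exists v, (v, u) \in s'].
Proof.
move=> sP; have [v vP] := partial_isometry_forth u sP.
have [w wP] := partial_isometry_forth u (partial_isometry_swap vP).
exists ((w, u) :: (u, v) :: s); split.
- have := partial_isometry_swap wP; rewrite /swap_pairs /= -map_comp.
  by rewrite (eq_map (g := id)) ?map_id //; case.
- by move=> p ps; rewrite !inE ps !orbT.
- by exists v; rewrite !inE eqxx orbT.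
- by exists w; rewrite inE eqxx.
Qed.

(** Back and forth: the partial isometry [s] is extended step by step, so that
    the [n]-th point of a dense sequence enters the domain and the range at
    stage [n]; the union of these extensions has dense domain and range, hence
    extends to [U] by completeness. *)
Lemma urysohn_ultrahomogeneous s : partial_isometry s ->
  exists g : Iso U, {in s, forall p, iso_fun g p.1 = p.2}.
Proof.
move=> sP.
have [D Dc Dd] := urysohn_separable hU.
have [//|//|u0 _] :=
  @katetov_realized _ _ (urysohn_extension hU) [::] (fun=> 0).
have [D0|[e]] := elimT pfcard_geP Dc.
  have [|x []] := Dd setT _ openT; first by exists u0.
  by rewrite D0.
have eD x r : 0 < r -> exists n, mdist x (e n) < r.
  move=> r0; have [||y [xy /= Dy]] := Dd (ball x r)°.
  - exists x; apply: nbhs_singleton; apply: nbhs_interior.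
    exact: nbhsx_ballx.
  - exact: open_interior.
  have [n _ en] := 'surj_e Dy; exists n.
  by have := interior_subset xy; rewrite ballEmdist /= en.
have [next nextP] : exists next : U -> {s | partial_isometry s} ->
      {s | partial_isometry s},
    forall u t, [/\ {subset sval t <= sval (next u t)},
      exists v, (u, v) \in sval (next u t)
    & exists v, (v, u) \in sval (next u t)].
  have step (p : U * {s | partial_isometry s}) :
      exists t' : {s | partial_isometry s}, [/\ {subset sval p.2 <= sval t'},
    exists v, (p.1, v) \in sval t' & exists v, (v, p.1) \in sval t'].
    case: p => u [t tP].
    have [t' [t'P h1 h2 h3]] := partial_isometry_step u tP.
    by exists (exist _ t' t'P).
  have [f fP] := choice step.
  by exists (fun u t => f (u, t)) => u t; exact: (fP (u, t)).
pose t := fix t n : {s | partial_isometry s} :=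
  if n is m.+1 then next (e m) (t m) else exist _ s sP.
have tmono m n : (m <= n)%N -> {subset sval (t m) <= sval (t n)}.
  elim: n => [|n IHn]; first by rewrite leqn0 => /eqP ->.
  rewrite leq_eqVlt ltnS => /predU1P[->//|/IHn tmn] p /tmn.
  by have [h _ _] := nextP (e n) (t n); exact: h.
pose P x y := exists n, (x, y) \in sval (t n).
have [|||g gP] := @preserves_mdist_extends P (urysohn_complete hU).
- move=> x y x' y' [m xy] [n xy'].
  exact: (svalP (t (maxn m n)) _ _ (tmono _ _ (leq_maxl m n) _ xy)
    (tmono _ _ (leq_maxr m n) _ xy')).
- move=> x r r0; have [n xn] := eD x r r0; exists (e n).
  by have [_ [v ev] _] := nextP (e n) (t n); exists v; split=> //; exists n.+1.
- move=> x r r0; have [n xn] := eD x r r0; exists (e n).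
  by have [_ _ [v ev]] := nextP (e n) (t n); exists v; split=> //; exists n.+1.
by exists g => -[x y] xys; apply: gP; exists 0%N.
Qed.

Lemma family_extends (T : finType) (e : T -> U) (k : T -> U) :
  (forall x y, mdist (k x) (k y) = mdist (e x) (e y)) ->
  exists h : Iso U, forall x, iso_fun h (e x) = k x.
Proof.
move=> kd.
have [|h hP] := urysohn_ultrahomogeneous (s := [seq (e x, k x) | x <- enum T]).
  by move=> _ _ /mapP[x _ ->] /mapP[y _ ->] /=; rewrite kd.
by exists h => x; apply: (hP (e x, k x)); apply: map_f; rewrite mem_enum.
Qed.

End homogeneity.

(** * Concentration of measure in powers of a finite set *)

Section concentration.
Context {R : realFieldType}.

(** Both sides are [2 * #|T| ^ 2] times the variance of [f] for the uniform
    measure. *)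
Lemma sum_sqr_diff (T : finType) (f : T -> R) :
  \sum_x \sum_y (f x - f y) ^+ 2 =
  2 * (#|T|%:R * \sum_x f x ^+ 2 - (\sum_x f x) ^+ 2).
Proof.
under eq_bigr => x _.
  under eq_bigr => y _ do rewrite sqrrB.
  rewrite big_split sumrB /= sumr_const sumrMnl -mulr_sumr.
  rewrite -[_ *+ #|T|]mulr_natl.
over.
rewrite big_split sumrB /= -mulr_sumr sumr_const -[_ *+ #|T|]mulr_natl.
rewrite sumrMnl -mulr_suml; ring.
Qed.

Context {S : finType}.

Definition hamming n (x y : n.-tuple S) : nat := \sum_i (tnth x i != tnth y i).

Lemma hamming_cons n s t (x y : n.-tuple S) :
  hamming [tuple of s :: x] [tuple of t :: y] = ((s != t) + hamming x y)%N.
Proof.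
rewrite /hamming big_ord_recl /=; congr (_ + _)%N.
by apply: eq_bigr => i _; rewrite !tnthS.
Qed.

Lemma hammingxx n (x : n.-tuple S) : hamming x x = 0%N.
Proof. by apply: big1 => i _; rewrite eqxx. Qed.

Lemma hamming_triangle n (y x z : n.-tuple S) :
  (hamming x z <= hamming x y + hamming y z)%N.
Proof.
rewrite -big_split /=; apply: leq_sum => i _.
by do 3 case: eqP => //=; move=> -> ->.
Qed.

Lemma hamming_sym n (x y : n.-tuple S) : hamming x y = hamming y x.
Proof. by apply: eq_bigr => i _; rewrite eq_sym. Qed.

Lemma big_tuple_cons n (F : n.+1.-tuple S -> R) :
  \sum_x F x = \sum_s \sum_(x : n.-tuple S) F [tuple of s :: x].
Proof.
rewrite pair_big /=.
rewrite (reindex (fun p : S * n.-tuple S => [tuple of p.1 :: p.2])) //=.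
apply: onW_bij; exists (fun x => (thead x, [tuple of behead x])).
  by move=> [s x]; congr (_, _); apply: val_inj.
by move=> x; rewrite [RHS]tuple_eta.
Qed.

(** Efron-Stein: the variance of a 1-Lipschitz function grows at most linearly
    with the number of coordinates. By induction on [n], the variance over
    [S^n.+1] is the mean of the variances on the fibres over the first
    coordinate ([fibre]), plus the variance of the means over these fibres
    ([base]); these means differ by at most 1, since changing the first
    coordinate changes [f] by at most 1. *)
Lemma variance_hamming n (f : n.-tuple S -> R) :
  (forall x y, `|f x - f y| <= (hamming x y)%:R) ->
  \sum_x \sum_y (f x - f y) ^+ 2 <= n%:R * (#|S| ^ n)%:R ^+ 2.
Proof.
elim: n => [|n IHn] in f *.
  move=> _; rewrite mul0r big1 // => x _; rewrite big1 // => y _.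
  by rewrite (tuple0 x) (tuple0 y) subrr expr0n.
move=> fL; set N : R := (#|S| ^ n)%:R.
pose F s := \sum_(x : n.-tuple S) f [tuple of s :: x].
have fibre s :
    2 * (N * (\sum_(x : n.-tuple S) f [tuple of s :: x] ^+ 2) - F s ^+ 2) <=
    n%:R * N ^+ 2.
  rewrite /N -card_tuple -sum_sqr_diff card_tuple; apply: IHn => x y.
  by have := fL [tuple of s :: x] [tuple of s :: y]; rewrite hamming_cons eqxx.
have base : 2 * (#|S|%:R * (\sum_s F s ^+ 2) - (\sum_s F s) ^+ 2)
    <= #|S|%:R ^+ 2 * N ^+ 2.
  rewrite -sum_sqr_diff.
  have -> : #|S|%:R ^+ 2 * N ^+ 2 = \sum_(s : S) \sum_(t : S) N ^+ 2.
    by rewrite !sumr_const -mulrnA -[RHS]mulr_natl natrM expr2.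
  apply: ler_sum => s _; apply: ler_sum => t _.
  rewrite -real_normK ?num_real // lerXn2r ?nnegrE ?normr_ge0 ?ler0n //.
  rewrite -sumrB; apply: le_trans (ler_norm_sum _ _ _) _.
  have -> : N = \sum_(x : n.-tuple S) 1 by rewrite sumr_const card_tuple.
  apply: ler_sum => x _; apply: le_trans (fL _ _) _.
  by rewrite hamming_cons hammingxx addn0 lern1 leq_b1.
rewrite sum_sqr_diff card_tuple !big_tuple_cons -/F.
have : \sum_s 2 * (N * (\sum_(x : n.-tuple S) f [tuple of s :: x] ^+ 2)
      - F s ^+ 2) <= \sum_(s : S) n%:R * N ^+ 2.
  by apply: ler_sum => s _; exact: fibre.
rewrite sumr_const -[_ *+ #|_|]mulr_natl -mulr_sumr sumrB -mulr_sumr.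
move: base; rewrite expnS natrM -/N -[n.+1%:R]natr1.
rewrite [#|xpredT|](_ : _ = #|S|) //.
set q := \sum_(s : S) \sum_(x : n.-tuple S) _; set Q := \sum_s F s ^+ 2.
set G := (\sum_s F s) ^+ 2; set M : R := #|S|%:R => base fib.
have M0 : 0 <= M by rewrite ler0n.
have := ler_wpM2l M0 fib; nra.
Qed.

(** Two sets of density at least [1/m] in [S^n] that are at Hamming distance at
    least [r] satisfy [r <= m * sqrt n], whatever the size of [S]. The distance
    [f] to [A] is 1-Lipschitz, vanishes on [A] and is at least [r] on [B], so
    the pairs in [A * B] alone contribute at least [#|A| * #|B| * r ^+ 2] to the
    sum that [variance_hamming] bounds. *)
Lemma concentration n (A B : {set n.-tuple S}) (m : nat) (r : R) :
  (0 < #|S|)%N -> (#|S| ^ n <= m * #|A|)%N -> (#|S| ^ n <= m * #|B|)%N ->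
  0 <= r -> {in A & B, forall x y, r <= (hamming x y)%:R} ->
  r ^+ 2 <= n%:R * m%:R ^+ 2.
Proof.
move=> S0 mA mB r0 rAB.
have N0 : (0 < #|S| ^ n)%N by rewrite expn_gt0 S0.
have [a Aa] : exists a, a \in A.
  apply/set0Pn; apply: contraTneq mA => ->.
  by rewrite cards0 muln0 leqn0 -lt0n.
pose d x := hamming x [arg min_(b < a in A) hamming x b].
have dle x b : b \in A -> (d x <= hamming x b)%N.
  by rewrite /d; case: arg_minnP => // c _; apply.
have dA x : exists2 b, b \in A & d x = hamming x b.
  by rewrite /d; case: arg_minnP => // c; exists c.
have dlip x y : (d x <= d y + hamming x y)%N.
  have [b Ab ->] := dA y; rewrite addnC.
  exact: leq_trans (dle x b Ab) (hamming_triangle _ _ _).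
pose f x : R := (d x)%:R.
have fL x y : `|f x - f y| <= (hamming x y)%:R.
  have := dlip x y; have := dlip y x; rewrite (hamming_sym y x).
  rewrite -!(ler_nat R) !natrD -/(f x) -/(f y) => h1 h2.
  by rewrite ler_norml; apply/andP; split; lra.
have := variance_hamming fL.
set N : R := (#|S| ^ n)%:R => var.
have low : (#|A| * #|B|)%:R * r ^+ 2 <= \sum_x \sum_y (f x - f y) ^+ 2.
  apply: (@le_trans _ _
    (\sum_(x in A) \sum_(y in B) (f x - f y) ^+ 2)); last first.
    rewrite big_mkcond; apply: ler_sum => x _.
    case: ifP => _; last by apply: sumr_ge0 => y _; exact: sqr_ge0.
    rewrite big_mkcond; apply: ler_sum => y _.
    by case: ifP => _ //; exact: sqr_ge0.
  have -> : (#|A| * #|B|)%:R * r ^+ 2 = \sum_(x in A) \sum_(y in B) r ^+ 2.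
    by rewrite !sumr_const -mulrnA mulnC mulr_natl.
  apply: ler_sum => x Ax; apply: ler_sum => y By.
  have -> : f x = 0.
    by apply/eqP; rewrite /f pnatr_eq0 -leqn0 -(hammingxx x) dle.
  rewrite sub0r sqrrN lerXn2r ?nnegrE ?ler0n //.
  by have [b Ab yb] := dA y; rewrite /f yb hamming_sym; exact: rAB.
have {}mA : N <= m%:R * #|A|%:R by rewrite -natrM ler_nat.
have {}mB : N <= m%:R * #|B|%:R by rewrite -natrM ler_nat.
have {}N0 : 0 < N by rewrite ltr0n.
rewrite -(@ler_pM2l _ (N ^+ 2)) ?exprn_gt0 //.
have AB : N ^+ 2 <= m%:R ^+ 2 * (#|A| * #|B|)%:R.
  rewrite natrM.
  rewrite [leRHS](_ : _ = (m%:R * #|A|%:R) * (m%:R * #|B|%:R)); last by ring.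
  by rewrite expr2; apply: ler_pM => //; exact: ltW.
apply: le_trans (ler_wpM2r (sqr_ge0 r) AB) _.
rewrite -mulrA [leRHS](_ : _ = m%:R ^+ 2 * (n%:R * N ^+ 2)); last by ring.
by apply: ler_wpM2l; [exact: sqr_ge0 | exact: le_trans low var].
Qed.

End concentration.

(** * Finite models of translation *)

(** A partial injection of a finite set extends to a permutation: the values are
    corrected one at a time by transpositions. *)
Lemma perm_extending (T : finType) (s : seq T) (f : T -> T) :
  {in s &, injective f} -> exists p : {perm T}, {in s, p =1 f}.
Proof.
elim: s => [|x s IHs] fI; first by exists 1%g.
have [|p pf] := IHs.
  by move=> y z ys zs; apply: fI; rewrite inE ?ys ?zs orbT.
exists (p * tperm (p x) (f x))%g => y; rewrite inE permM.
case: (eqVneq y x) => [->|yx] /= ys; first by rewrite tpermL.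
have fyx : f x != f y.
  by apply: contra_neq yx => fxy; apply: fI; rewrite ?inE ?eqxx ?ys ?orbT.
by rewrite (pf y ys) tpermD // -(pf y ys) (inj_eq perm_inj) eq_sym.
Qed.

Section word_balls.
Context (G : groupType) (gs : seq G).
Local Open Scope group_scope.

Fixpoint word_ball n : seq G :=
  if n is m.+1 then
    word_ball m ++ [seq h * g | h <- word_ball m, g <- gs]
                ++ [seq h * g^-1 | h <- word_ball m, g <- gs]
  else [:: 1].

Lemma word_ballS n : {subset word_ball n <= word_ball n.+1}.
Proof. by move=> h hn; rewrite mem_cat hn. Qed.

Lemma word_ball_mono m n : (m <= n)%N -> {subset word_ball m <= word_ball n}.
Proof.
elim: n => [|n IHn]; first by rewrite leqn0 => /eqP ->.
by rewrite leq_eqVlt ltnS => /predU1P[->//|/IHn mn] h /mn; exact: word_ballS.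
Qed.

Lemma word_ball1 n : 1 \in word_ball n.
Proof. by apply: (word_ball_mono (leq0n n)); rewrite inE. Qed.

Lemma word_ballM n h g :
  g \in gs -> h \in word_ball n -> h * g \in word_ball n.+1.
Proof.
by move=> ggs hn; rewrite !mem_cat; apply/or3P/Or32; exact: allpairs_f.
Qed.

Lemma word_ballMV n h g :
  g \in gs -> h \in word_ball n -> h * g^-1 \in word_ball n.+1.
Proof.
move=> ggs hn; rewrite !mem_cat; apply/or3P/Or33.
exact: (allpairs_f (fun h g => h * g^-1)).
Qed.

(** The length of [h] as a word in the elements of [gs] and their inverses,
    truncated at [r]. *)
Definition word_length r (h : G) : nat := \sum_(k < r) (h \notin word_ball k).

Lemma word_length1 r : word_length r 1 = 0%N.
Proof. by apply: big1 => k _; rewrite word_ball1. Qed.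

Lemma word_length_out r h : h \notin word_ball r.-1 -> word_length r h = r.
Proof.
move=> hr; rewrite -[RHS]card_ord -sum1_card; apply: eq_bigr => k _.
case: r => [|r] in hr k *; first by case: k.
rewrite (contra _ hr) //; apply: word_ball_mono; exact: ltn_ord k.
Qed.

Lemma word_length_step r h k :
  (forall n, h \in word_ball n -> k \in word_ball n.+1) ->
  (word_length r k <= (word_length r h).+1)%N.
Proof.
move=> hk; case: r => [|r]; first by rewrite /word_length big_ord0.
rewrite /word_length big_ord_recl big_ord_recr /= -add1n.
apply: leq_add; first exact: leq_b1.
apply: leq_trans (leq_addr _ _); apply: leq_sum => i _.
by case: (boolP (h \in _)) => [/hk ->|_] //; exact: leq_b1.
Qed.

Lemma word_lengthMle r h g : g \in gs ->
  (word_length r (h * g) <= (word_length r h).+1)%N.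
Proof. by move=> ggs; apply: word_length_step => n; exact: word_ballM. Qed.

Lemma word_lengthMge r h g : g \in gs ->
  (word_length r h <= (word_length r (h * g)).+1)%N.
Proof.
move=> ggs; apply: word_length_step => n hn.
by rewrite -[h](mulgK g); exact: word_ballMV.
Qed.

End word_balls.

Lemma min_lipschitz (R : realType) (c a b : R) :
  `|Num.min c a - Num.min c b| <= `|a - b|.
Proof.
by rewrite /Num.min; do 2 case: ltP => ?; rewrite ler_norml;
  have := ler_norm (a - b); have := ler_norm (b - a); rewrite (distrC b a);
  have := normr_ge0 (a - b) => ? ? ?; apply/andP; split; lra.
Qed.

(** A finite substitute for the slices [u Y], [u : Iso U], where the point [g z]
    of slice [u] is the point [z] of slice [u * g]. The set [S] is the group of
    permutations of a ball of radius [r] around 1 in the subgroup generated by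
    [gs], and [tau g] is right multiplication by a permutation extending the
    partial map [b |-> b * g] of the ball. The pseudometric [rho] is the
    supremum distance for a family of functions [phi u y z] with values in
    [[0, D]], indexed by [y] in [Y] and [t] in [S]: at the point [z] of slice
    [s], [u] is the element of the ball to which [t^-1 * s] sends 1. For
    [t = s], [u] is 1 and the function is the distance to [y] in that slice. All
    are 1-Lipschitz in [z]. Moving from [g z] in slice [s] to [z] in slice
    [tau g s] replaces [u] by [u * g], which changes the word length by at
    most 1, hence [phi] by at most [eps]; where [u * g] leaves the ball, [u]
    and its image under the permutation are both on the boundary, where [phi]
    is constantly [D]. *)
Lemma finite_translation_model (R : realType) (U : metricType R)
    (gs : seq (Iso U)) (Y : seq U) (D eps : R) :
  0 < eps -> 0 <= D -> {in Y &, forall y z, mdist y z <= D} ->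
  exists (S : finType) (s0 : S) (tau : Iso U -> S -> S)
    (rho : S * U -> S * U -> R),
  [/\ pseudometric rho,
      forall g, injective (tau g),
      forall s, {in Y &, forall y z, rho (s, y) (s, z) = mdist y z},
      {in gs, forall g s z, rho (s, iso_fun g z) (tau g s, z) <= eps}
    & forall p q, rho p q <= D].
Proof.
move=> eps0 D0 YD.
(* The radius [r] makes the word length penalty reach [D] on the boundary. *)
pose r := (Num.bound (D / eps)).+1.
have rD : D <= eps * r%:R.
  rewrite mulrC -ler_pdivrMr // -natr1 ler_wpDr // ltW //.
  by apply: archi_boundP; rewrite divr_ge0 // ltW.
pose ball_r : finType := seq_sub (word_ball gs r).
pose b1 : ball_r := SeqSub (word_ball1 gs r).
pose step (g : Iso U) (b : ball_r) : ball_r := insubd b (ssval b * g)%g.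
have stepE g b : (ssval b * g)%g \in word_ball gs r ->
    ssval (step g b) = (ssval b * g)%g.
  by move=> bg; rewrite /step -[LHS]/(val _) val_insubd bg.
have [pi piP] : exists pi : Iso U -> {perm ball_r}, forall g b,
    (ssval b * g)%g \in word_ball gs r -> ssval (pi g b) = (ssval b * g)%g.
  suff /choice : forall g : Iso U, exists p : {perm ball_r}, forall b,
      (ssval b * g)%g \in word_ball gs r -> ssval (p b) = (ssval b * g)%g.
    by case=> pi piP; exists pi => g b; exact: piP.
  move=> g.
  have [|p pP] := @perm_extending _
    [seq b <- enum ball_r | (ssval b * g)%g \in word_ball gs r] (step g).
    move=> b c; rewrite !mem_filter => /andP[hb _] /andP[hc _].
    move/(congr1 (@ssval _ _)); rewrite !stepE // => /mulIg bc.
    exact: val_inj.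
  exists p => b hb; rewrite pP ?stepE //.
  by rewrite mem_filter hb mem_enum.
pose phi (u : Iso U) y z :=
  Num.min D (mdist y (iso_fun u z) + eps * (word_length gs r u)%:R).
have phi_ge0 u y z : 0 <= phi u y z.
  by rewrite /phi le_min D0 addr_ge0 ?mdist_ge0 // mulr_ge0 // ltW.
have phi_leD u y z : phi u y z <= D by rewrite /phi ge_min lexx.
have phi_out u y z : u \notin word_ball gs r.-1 -> phi u y z = D.
  move=> /(word_length_out (r := r)) ur; rewrite /phi ur; apply/min_idPl.
  by rewrite (le_trans rD) // lerDr mdist_ge0.
have phi_lip u y z z' : `|phi u y z - phi u y z'| <= mdist z z'.
  apply: le_trans (min_lipschitz _ _ _) _.
  have := metric_triangle y (iso_fun u z') (iso_fun u z).
  have := metric_triangle y (iso_fun u z) (iso_fun u z').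
  rewrite [mdist _ (iso_fun u z)]metric_sym.
  rewrite [mdist (iso_fun u z') (iso_fun u z)]metric_sym iso_dist => h1 h2.
  by rewrite ler_norml; apply/andP; split; lra.
have phi_step g b y z : g \in gs ->
    `|phi (ssval b) y (iso_fun g z) - phi (ssval (pi g b)) y z| <= eps.
  move=> ggs; have [bg|bg] := boolP ((ssval b * g)%g \in word_ball gs r).
    rewrite piP //; apply: le_trans (min_lipschitz _ _ _) _.
    have := word_lengthMle r (ssval b) ggs.
    have := word_lengthMge r (ssval b) ggs.
    rewrite -!(ler_nat R) -!natr1.
    set l := (word_length _ _ _)%:R; set l' := (word_length _ _ _)%:R => h1 h2.
    rewrite -[iso_fun (_ * _)%g z]/(iso_fun (ssval b) (iso_fun g z)).
    rewrite opprD addrACA subrr add0r -mulrBr normrM gtr0_norm // ler_piMr //.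
      exact: ltW.
    by rewrite ler_norml; apply/andP; split; lra.
  have uout : ssval b \notin word_ball gs r.-1.
    by apply: contra bg; exact: (@word_ballM _ gs r.-1 _ g ggs).
  have vout : ssval (pi g b) \notin word_ball gs r.-1.
    (* Otherwise [pi g] would send [b], whose translate leaves the ball, and the
       [c] of the ball with [c * g = pi g b] to the same point. *)
    apply/negP => /(word_ballMV ggs) vr.
    pose c : ball_r := SeqSub vr.
    have gcE : ssval (pi g c) = ssval (pi g b) by rewrite piP /= mulgVK ?ssvalP.
    have cb : c = b by apply: (@perm_inj _ (pi g)); exact: val_inj.
    by move/negP: bg; apply; rewrite -cb /= mulgVK ssvalP.
  by rewrite !phi_out // subrr normr0 ltW.
pose f (i : {perm ball_r} * U) (p : {perm ball_r} * U) :=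
  phi (ssval ((i.1^-1 * p.1)%g b1)) i.2 p.2.
pose J := [seq (s, y) | s <- enum {perm ball_r}, y <- Y].
exists {perm ball_r}, 1%g, (fun g s => (s * pi g)%g), (sup_dist J f); split.
- exact: sup_dist_pseudometric.
- by move=> g; exact: mulIg.
- move=> s y z Yy Yz; apply/le_anti/andP; split.
    by apply: sup_dist_le => [|i _]; [exact: mdist_ge0 | exact: phi_lip].
  have Jsy : (s, y) \in J by apply: allpairs_f; rewrite ?mem_enum.
  apply: le_trans (le_sup_dist f (s, y) (s, z) Jsy).
  rewrite /f /= mulVg perm1 /phi /= word_length1 mulr0 !addr0.
  rewrite -[iso_fun _ y]/y -[iso_fun _ z]/z mdistxx.
  rewrite (min_idPr D0) (min_idPr (YD _ _ Yy Yz)) sub0r normrN.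
  exact: ler_norm.
- move=> g ggs s z; apply: sup_dist_le => [|i _]; first exact: ltW.
  have := phi_step g ((i.1^-1 * s)%g b1) i.2 z ggs.
  by rewrite -permM -mulgA.
- move=> p q; apply: sup_dist_le => // i _; rewrite /f.
  have := phi_ge0 (ssval ((i.1^-1 * p.1)%g b1)) i.2 p.2.
  have := phi_ge0 (ssval ((i.1^-1 * q.1)%g b1)) i.2 q.2.
  have := phi_leD (ssval ((i.1^-1 * p.1)%g b1)) i.2 p.2.
  have := phi_leD (ssval ((i.1^-1 * q.1)%g b1)) i.2 q.2.
  by move=> ? ? ? ?; rewrite ler_norml; apply/andP; split; lra.
Qed.

(** * A Ramsey property of isometries *)

Section ramsey.
Context {R : realType} (U : metricType R).
Context (hU : urysohn_space U).

(** A family of isometries indexed by [S^n], on which right composition with [g]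
    is nearly a coordinatewise translation, and which varies little when few
    coordinates change. It comes from an embedding in [U] of the model on
    [S * Y], averaged over [n] coordinates. The constant [D], a bound on the
    diameter of [Y], does not depend on [n]. *)
Lemma hamming_isometries (gs : seq (Iso U)) (F : seq U) (eps : R) : 0 < eps ->
  exists2 D : R, 0 <= D & forall n, (0 < n)%N ->
  exists (S : finType) (s0 : S) (tau : Iso U -> S -> S)
    (h : n.-tuple S -> Iso U),
  [/\ forall g, injective (tau g),
      {in gs & F, forall g z s,
        mdist (iso_fun (h s) (iso_fun g z))
          (iso_fun (h (map_tuple (tau g) s)) z) <= eps}
    & {in gs & F, forall g z s t,
        mdist (iso_fun (h s) (iso_fun g z)) (iso_fun (h t) (iso_fun g z))
          <= D * (hamming s t)%:R / n%:R}].
Proof.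
move=> eps0; pose Y := F ++ [seq iso_fun g z | g <- gs, z <- F].
pose D := \big[Num.max/0]_(p <- [seq (y, z) | y <- Y, z <- Y]) mdist p.1 p.2.
have D0 : 0 <= D by exact: bigmax_ge_id.
have YD : {in Y &, forall y z, mdist y z <= D}.
  move=> y z Yy Yz.
  exact: (@le_bigmax_seq _ _ _ _ 0 (y, z) predT (fun p => mdist p.1 p.2)
    (allpairs_f _ Yy Yz)).
have YF z : z \in F -> z \in Y by rewrite mem_cat => ->.
have YgF g z : g \in gs -> z \in F -> iso_fun g z \in Y.
  by move=> ggs zF; rewrite mem_cat; apply/orP; right; exact: allpairs_f.
have [S [s0 [tau [rho [rhoP tau_inj rhoY rho_tau rhoD]]]]] :=
  finite_translation_model gs eps0 D0 YD.
exists D => // n n0; exists S, s0, tau.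
have n0R : 0 < n%:R :> R by rewrite ltr0n.
pose T : finType := (n.-tuple S * seq_sub Y)%type.
pose pt (p : T) (i : 'I_n) := (tnth p.1 i, ssval p.2).
pose dT (p q : T) := n%:R^-1 * \sum_i rho (pt p i) (pt q i).
have dTP : pseudometric dT.
  have [h1 h2 h3] := @mean_pseudometric R _ rho n rhoP.
  by split=> *; [exact: h1 | exact: h2 | exact: h3].
have [k kP] := finite_pseudometric_embeds (urysohn_extension hU) dTP.
have /choice[h hP] : forall s : n.-tuple S, exists h : Iso U,
    forall y : seq_sub Y, iso_fun h (ssval y) = k (s, y).
  move=> s; apply: (family_extends hU) => x y; rewrite kP /dT.
  under eq_bigr => i _ do rewrite /pt /= rhoY ?ssvalP //.
  by rewrite sumr_const card_ord -[mdist _ _ *+ n]mulr_natl mulKf ?gt_eqF.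
have {}hP s z (Yz : z \in Y) : iso_fun (h s) z = k (s, SeqSub Yz).
  by rewrite -hP.
exists h; split=> //.
- move=> g z ggs zF s; have Yz := YF z zF; have Ygz := YgF g z ggs zF.
  rewrite (hP _ _ Yz) (hP _ _ Ygz) kP /dT /=.
  rewrite mulrC ler_pdivrMr // mulr_natr -[n in leRHS]card_ord -sumr_const.
  by apply: ler_sum => i _; rewrite /pt /= tnth_map; exact: rho_tau.
- move=> g z ggs zF s t; have Ygz := YgF g z ggs zF.
  rewrite (hP s _ Ygz) (hP t _ Ygz) kP /dT /=.
  rewrite mulrC ler_pM2r ?invr_gt0 // /hamming natr_sum mulr_sumr.
  apply: ler_sum => i _; rewrite /pt /=; have [rxx _ _] := rhoP.
  by case: eqVneq => [->|_] /=; rewrite ?rxx ?mulr0 // mulr1.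
Qed.

(** The choice of [i] makes the class of colour [i] dense enough in [S^n] for
    concentration to apply to it and to its translate by [tau (g i)]. *)
Lemma isometry_ramsey (I : finType) (g : I -> Iso U) (c : Iso U -> I)
    (F : seq U) (delta : R) : 0 < delta ->
  exists h h' : Iso U, c h = c h' /\
    {in F, forall z,
      mdist (iso_fun h' z) (iso_fun h (iso_fun (g (c h)) z)) <= delta}.
Proof.
move=> delta0; have delta20 : 0 < delta / 2 by lra.
have [D D0 hD] := hamming_isometries [seq g i | i <- enum I] F delta20.
pose m := #|I|; pose a := delta / (2 * (D + 1)).
(* Tuples at Hamming distance less than [a * n] give isometries that are within
   [delta / 2] of each other; [n] is so large that [a * n > m * sqrt n]. *)
have a0 : 0 < a by rewrite divr_gt0 // mulr_gt0 //; lra.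
pose n := (Num.bound ((m%:R / a) ^+ 2)).+1.
have nP : m%:R ^+ 2 < n%:R * a ^+ 2.
  rewrite -ltr_pdivrMr ?exprn_gt0 // -expr_div_n /n -natr1 ltr_wpDr //.
  by apply: archi_boundP; exact: sqr_ge0.
have [S [s0 [tau [h [tau_inj htau hham]]]]] := hD n isT.
have n0R : 0 < n%:R :> R by rewrite ltr0n.
pose A i := [set s : n.-tuple S | c (h s) == i]%SET.
have [i Ai] : exists i, (#|S| ^ n <= m * #|A i|)%N.
  have /card_gt0P[i0 _] : (0 < #|I|)%N by apply/card_gt0P; exists (c 1%g).
  have [i _ iP] := @arg_maxnP _ i0 xpredT (fun i => #|A i|) isT.
  exists i; rewrite -card_tuple -[leqLHS]sum1_card.
  rewrite (partition_big (fun s => c (h s)) xpredT) //=.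
  have -> : (m * #|A i| = \sum_(j : I) #|A i|)%N by rewrite sum_nat_const.
  apply: leq_sum => j _.
  by rewrite sum1dep_card; exact: iP.
pose mt : n.-tuple S -> n.-tuple S := map_tuple (tau (g i)).
have mt_inj : injective mt.
  by move=> s t /(congr1 val) /= /(inj_map (tau_inj (g i))); exact: val_inj.
pose B := (mt @^-1: A i)%SET.
have Bi : (#|S| ^ n <= m * #|B|)%N.
  by rewrite card_preimset.
have S0 : (0 < #|S|)%N by apply/card_gt0P; exists s0.
have [[s [t [As Bt st]]]|far] :=
    pselect (exists s t, [/\ s \in A i, t \in B &
      (hamming s t)%:R < a * n%:R]); last first.
  have {}far : {in A i & B, forall s t, a * n%:R <= (hamming s t)%:R}.
    move=> s t As Bt; rewrite leNgt; apply/negP => st.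
    by apply: far; exists s, t.
  have := concentration S0 Ai Bi (mulr_ge0 (ltW a0) (ltW n0R)) far.
  rewrite exprMn mulrC [X in X * _]expr2 -mulrA ler_pM2l //.
  by rewrite leNgt nP.
exists (h s), (h (map_tuple (tau (g i)) t)).
move: As Bt; rewrite !inE => /eqP hs /eqP ht; rewrite hs ht; split=> // z zF.
have gi : g i \in [seq g i | i <- enum I] by rewrite map_f ?mem_enum.
apply: le_trans (metric_triangle _ (iso_fun (h t) (iso_fun (g i) z)) _) _.
rewrite [delta]splitr lerD //; first by rewrite metric_sym htau.
apply: le_trans (hham _ _ gi zF t s) _.
rewrite ler_pdivrMr // hamming_sym.
apply: (@le_trans _ _ (D * (a * n%:R))); first by rewrite ler_wpM2l // ltW.
rewrite mulrA ler_wpM2r // /a mulrA ler_pdivrMr ?mulr_gt0 //; lra.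
Qed.

End ramsey.

(** * Fixed points *)

Lemma nbhs_Iso (R : realType) (U : metricType R) (g : Iso U) (V : set (Iso U)) :
  nbhs g V ->
  exists F : seq U, exists2 delta : R, 0 < delta &
    forall v,
      {in F, forall z, mdist (iso_fun g z) (iso_fun v z) < delta} -> V v.
Proof.
pose N (p : seq U * R) :=
  [set v : Iso U | {in p.1, forall z, mdist (iso_fun g z) (iso_fun v z) < p.2}].
pose B := filter_from [set p : seq U * R | 0 < p.2] N.
have FB : Filter B.
  apply: filter_from_filter; first by exists ([::], 1); exact: ltr01.
  move=> [F d] [F' d'] /= d0 d'0; exists (F ++ F', Num.min d d').
    by rewrite /= lt_min d0.
  move=> v /= vP; split=> z zF /=; have := vP z;
    rewrite mem_cat zF ?orbT lt_min.
    by move=> /(_ isT)/andP[].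
  by move=> /(_ isT)/andP[].
have Bg : B --> g.
  apply/iso_cvgP => z; apply/cvg_ballP => e e0; exists ([:: z], e) => //= v.
  by move=> /(_ z); rewrite mem_head ballEmdist => /(_ isT).
by move=> /Bg[[F d] /= d0 NV]; exists F, d.
Qed.

Theorem theorem4p11 (R : realType) (U : metricType R) (hU : urysohn_space U) :
  extremely_amenable (Iso U).
Proof.
move=> X act [x0 _] Xcompact Xhaus act1 actM actC.
apply: contrapT => nofix.
have local x : exists q : Iso U * set X * set (Iso U), let: (g, N, V) := q in
    [/\ open N, N x, nbhs (g^-1)%g V &
      forall v y, V v -> N y -> ~ N (act v y)].
  have [g gx] : exists g, act g x <> x.
    apply: contrapT => h; apply: nofix; exists x => g.
    by apply: contrapT => gx; apply: h; exists g.
  have := Xhaus; rewrite open_hausdorff.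
  move=> /(_ (act g x) x) [|[P Q] /=]; first exact/eqP.
  move=> [Pgx Qx] [oP oQ /eqP PQ].
  rewrite !inE in Pgx Qx.
  have : nbhs (g, x) [set p : Iso U * X | P (act p.1 p.2)].
    by apply: (actC (g, x)); exact: open_nbhs_nbhs.
  move=> [[V M] /= [Vg Mx] VM].
  exists (g^-1, Q `&` M°, V)%g; split.
  - by apply: openI => //; exact: open_interior.
  - by split.
  - by rewrite invgK.
  - move=> v y Vv [_ My] [Qvy _].
    have : (P `&` Q) (act v y).
      split=> //; apply: (VM (v, y)); split=> //=; exact: interior_subset.
    by rewrite PQ.
have [q qP] := choice local.
(* The covering form of compactness is stated for pointed spaces. *)
pose pX : ptopologicalType :=
  HB.pack (Topological.sort X) (isPointed.Build X x0).
have Xcover : @cover_compact X setT.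
  by have := Xcompact : @compact pX setT; rewrite compact_cover.
have [||D _ DX] := Xcover X setT (fun x => (q x).1.2).
- by move=> x _; have := qP x; case: (q x) => [[]] ? ? ? [].
- by move=> x _; exists x => //; have := qP x; case: (q x) => [[]] ? ? ? [].
pose I : finType := D.
pose g (i : I) := (q (val i)).1.1.
pose N (i : I) := (q (val i)).1.2.
pose V (i : I) := (q (val i)).2.
have gNV i : nbhs (g i)^-1%g (V i) /\
    forall v y, V i v -> N i y -> ~ N i (act v y).
  by have := qP (val i); rewrite /g /N /V; case: (q (val i)) => [[]] ? ? ? [].
have /choice[c cP] : forall h : Iso U, exists i : I, N i (act h^-1%g x0).
  move=> h; have [i /= iD Ni] := DX (act h^-1%g x0) Logic.I.
  by exists [` iD]%fset.
have /choice[b bP] : forall i : I, exists b : seq U * R, 0 < b.2 /\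
    forall v, {in b.1, forall z,
      mdist (iso_fun (g i)^-1%g z) (iso_fun v z) < b.2} -> V i v.
  by move=> i; have [F [d d0 FV]] := nbhs_Iso (gNV i).1; exists (F, d).
pose F := flatten [seq [seq iso_fun (g i)^-1%g z | z <- (b i).1] | i <- enum I].
pose delta := \big[Num.min/1]_(i : I) ((b i).2 / 2).
have delta0 : 0 < delta.
  by apply/bigmin_gtP; split=> // i _; rewrite divr_gt0 //; exact: (bP i).1.
have [h [h' [chh' hh']]] := isometry_ramsey hU g c F delta0.
set i := c h in chh' hh'.
(* The element [h'^-1 * h] of [V i] maps [h^-1 x0] to [h'^-1 x0]. *)
have [_] := gNV i; apply.
- apply: ((bP i).2 (h'^-1 * h)%g) => z zb.
  have gzF : iso_fun (g i)^-1%g z \in F.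
    by apply/flattenP; exists [seq iso_fun (g i)^-1%g z | z <- (b i).1];
      apply: map_f; rewrite ?mem_enum.
  have := hh' _ gzF.
  rewrite -[iso_fun (g i)^-1%g z]/(iso_invfun (g i) z).
  rewrite -[iso_fun (h'^-1 * h)%g z]/(iso_invfun h' (iso_fun h z)).
  rewrite iso_invfunK -(iso_dist h' _ (iso_invfun _ _)) iso_invfunK.
  move=> /le_lt_trans; apply; apply: (@le_lt_trans _ _ ((b i).2 / 2)).
    exact: bigmin_le.
  by have := (bP i).1; lra.
- exact: cP.
- by rewrite -actM mulgK chh'; exact: cP.
Qed.
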